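(* Let $\mathbb{K}_2^n\subset\mathbb{R}^n$ be the second-order cone, let $c_1,c_2\in\mathbb{R}^n$ and $c_{1,0},c_{2,0}\in\{0,\pm1\}$ with $c_{1,0}\ge c_{2,0}$, and let $C_i:=\{x\in\mathbb{K}_2^n:\ c_i^\top x\ge c_{i,0}\}$ for $i\in\{1,2\}$. Suppose that $C_1\not\subseteq C_2$, $C_2\not\subseteq C_1$, and $C_i\cap\operatorname{int}\mathbb{K}_2^n\ne\emptyset$ for $i\in\{1,2\}$. Let $\beta>0$ be such that $\beta c_{1,0}\ge c_{2,0}$ and $\beta c_1-c_2\notin\pm\mathbb{K}_2^n$, and set $\mathcal{N}_1(\beta):=\|\beta\tilde c_1-\tilde c_2\|_2^2-(\beta c_{1,n}-c_{2,n})^2$. Then $$(B)\quad -2c_{2,0}+(\beta c_1+c_2)^\top x\le\sqrt{\big((\beta c_1-c_2)^\top x\big)^2+\mathcal{N}_1(\beta)\big(x_n^2-\|\tilde x\|_2^2\big)}$$ holds for all $x\in\mathbb{K}_2^n$ that satisfy $\beta c_1^\top x\le c_{2,0}$ or $c_2^\top x\le c_{2,0}$. Furthermore, if $$\{x\in\mathbb{K}_2^n:\ \beta c_1^\top x>c_{2,0},\ c_2^\top x>c_{2,0}\}=\emptyset,$$ then $(B)$ holds for all $x\in\mathbb{K}_2^n$, and for $x\in\mathbb{K}_2^n$ the condition $$\mathcal{N}_1(\beta)\,x+2(c_2^\top x-c_{2,0})\begin{pmatrix}\beta\tilde c_1-\tilde c_2\\ -\beta c_{1,n}+c_{2,n}\end{pmatrix}\in\mathbb{K}_2^n$$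 is equivalent to $$2c_{2,0}-(\beta c_1+c_2)^\top x\le\sqrt{\big((\beta c_1-c_2)^\top x\big)^2+\mathcal{N}_1(\beta)\big(x_n^2-\|\tilde x\|_2^2\big)}.$$
   Context: For $x\in\mathbb{R}^n$, $\tilde x:=(x_1;\dots;x_{n-1})$, and $c_{i,n}$ is the $n$-th entry of $c_i$, $\tilde c_i$ its first $n-1$ entries. $\mathbb{K}_2^n:=\{x\in\mathbb{R}^n:\|\tilde x\|_2\le x_n\}$. $\operatorname{int}$ denotes interior; $v\notin\pm\mathbb{K}$ means $v\notin\mathbb{K}$ and $v\notin-\mathbb{K}$. *)

(* Defs.v *)
From mathcomp Require Import all_boot all_order all_algebra.
From mathcomp Require Import all_classical all_reals all_analysis.

Set Implicit Arguments.
Unset Strict Implicit.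
Unset Printing Implicit Defensive.

Import Order.TTheory GRing.Theory Num.Theory.

Local Open Scope classical_set_scope.
Local Open Scope ring_scope.

(* The Euclidean norm; the norm MathComp-Analysis puts on matrices is the
   max-norm. *)
Definition norm2 (R : realType) (n : nat) (x : 'cV[R]_n) : R :=
  Num.sqrt (\sum_(i < n) x i 0 ^+ 2).

Definition dot (R : realType) (n : nat) (c x : 'cV[R]_n) : R :=
  (c^T *m x) 0 0.

(* The ambient dimension is n + 1, so that every vector splits as (hd x; lst x)
   with lst x its last entry and hd x the n entries before it. *)
Definition hd (R : realType) (n : nat) (x : 'cV[R]_(n + 1)) : 'cV[R]_n :=
  usubmx x.

Definition lst (R : realType) (n : nat) (x : 'cV[R]_(n + 1)) : R :=
  dsubmx x 0 0.

Definition soc (R : realType) (n : nat) : set 'cV[R]_(n + 1) :=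
  [set x | norm2 (hd x) <= lst x].
Arguments soc : clear implicits.

Definition disj_term (R : realType) (n : nat) (c : 'cV[R]_(n + 1)) (c0 : R) :
    set 'cV[R]_(n + 1) :=
  [set x | soc R n x /\ c0 <= dot c x].

Definition N1 (R : realType) (n : nat) (c1 c2 : 'cV[R]_(n + 1)) (beta : R) : R :=
  norm2 (beta *: hd c1 - hd c2) ^+ 2 - (beta * lst c1 - lst c2) ^+ 2.

(* Main.v *)
Require Import Defs.
From mathcomp Require Import all_boot all_order all_algebra.
From mathcomp Require Import all_classical all_reals all_analysis.
From mathcomp Require Import ring lra.

Set Implicit Arguments.
Unset Strict Implicit.
Unset Printing Implicit Defensive.

Import Order.TTheory GRing.Theory Num.Theory.
Import numFieldNormedType.Exports.

Local Open Scope classical_set_scope.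
Local Open Scope ring_scope.

(** Write [d = beta c1 - c2], [N = N1 c1 c2 beta], [a = beta c1^T x],
[b = c2^T x], [t = c20], and let [q] be the value at [x] of the Lorentz form
[L(x, x) = x_n^2 - |hd x|^2].  The cone consists of the vectors with
[L(x, x) >= 0] and last entry nonnegative ([socP]), so [d] lying outside
both the cone and its opposite means exactly that [N = - L(d, d)] is positive.

Inequality (B) reads [(a - t) + (b - t) <= sqrt ((a - b)^2 + N q)].  The root is
at least [|a - b|], which already dominates the left-hand side as soon as one of
[a - t], [b - t] is nonpositive; this gives the first claim and, when both are
never positive together, (B) on the whole cone.

For the equivalence, let [w] be the reflection of [d] in the hyperplane of zero
last entry, and [v = N x + 2 (b - t) w].  Since [L(x, w) = - d^T x = b - a] and
[L(w, w) = - N],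
  [L(v, v) = N (N q - 4 (a - t) (b - t))].
On the other side, (B) bounds [(a - t) + (b - t)] from above by the root, so the
reverse bound, on [(t - a) + (t - b)], amounts to [((a - t) + (b - t))^2 <= (a -
b)^2 + N q], that is [4 (a - t) (b - t) <= N q]. Hence the reverse inequality
with the square root states that [L(v, v) >= 0], that is, that [v] is in the
cone or in its opposite, and the latter alternative must be shown to imply the
former. If [- v] is in the cone, then [N x - v] is a sum of two elements of the
cone, hence of nonnegative square by self-duality ([soc_lorentz_ge0]); but it
equals [- 2 (b - t) w], and [w] has negative square. So [b = t], and [v = N x]
is in the cone after all ([soc_add_lorentz_lt0]). *)

(** * The Lorentz form *)

Lemma dotE (R : realType) (n : nat) (c x : 'cV[R]_n) :
  dot c x = \sum_(i < n) c i 0 * x i 0.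
Proof. by rewrite /dot mxE; apply: eq_bigr => i _; rewrite mxE. Qed.

Lemma dotC (R : realType) (n : nat) (c x : 'cV[R]_n) : dot c x = dot x c.
Proof. by rewrite !dotE; apply: eq_bigr => i _; rewrite mulrC. Qed.

Lemma dotDl (R : realType) (n : nat) (c d x : 'cV[R]_n) :
  dot (c + d) x = dot c x + dot d x.
Proof. by rewrite /dot linearD mulmxDl mxE. Qed.

Lemma dotZl (R : realType) (n : nat) (k : R) (c x : 'cV[R]_n) :
  dot (k *: c) x = k * dot c x.
Proof. by rewrite /dot linearZ -scalemxAl mxE. Qed.

Lemma dotBl (R : realType) (n : nat) (c d x : 'cV[R]_n) :
  dot (c - d) x = dot c x - dot d x.
Proof. by rewrite dotDl -scaleN1r dotZl mulN1r. Qed.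

Lemma dotxx_ge0 (R : realType) (n : nat) (x : 'cV[R]_n) : 0 <= dot x x.
Proof. by rewrite dotE; apply: sumr_ge0 => i _; rewrite -expr2 sqr_ge0. Qed.

Lemma dotxx_eq0 (R : realType) (n : nat) (x : 'cV[R]_n) :
  (dot x x == 0) = (x == 0).
Proof.
apply/idP/eqP => [|->]; last by rewrite /dot mulmx0 mxE eqxx.
rewrite dotE psumr_eq0 => [/allP x0|i _]; last by rewrite -expr2 sqr_ge0.
apply/matrixP => i j; rewrite ord1 mxE.
by have := x0 i (mem_index_enum i); rewrite mulf_eq0 orbb => /eqP.
Qed.

Lemma sqr_norm2 (R : realType) (n : nat) (x : 'cV[R]_n) :
  norm2 x ^+ 2 = dot x x.
Proof.
rewrite /norm2 sqr_sqrtr; last by apply: sumr_ge0 => i _; rewrite sqr_ge0.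
by rewrite dotE; apply: eq_bigr => i _; rewrite expr2.
Qed.

Lemma hdD (R : realType) (n : nat) (x y : 'cV[R]_(n + 1)) :
  hd (x + y) = hd x + hd y.
Proof. exact: linearD. Qed.

Lemma hdZ (R : realType) (n : nat) (k : R) (x : 'cV[R]_(n + 1)) :
  hd (k *: x) = k *: hd x.
Proof. exact: linearZ. Qed.

Lemma lstD (R : realType) (n : nat) (x y : 'cV[R]_(n + 1)) :
  lst (x + y) = lst x + lst y.
Proof. by rewrite /lst linearD mxE. Qed.

Lemma lstZ (R : realType) (n : nat) (k : R) (x : 'cV[R]_(n + 1)) :
  lst (k *: x) = k * lst x.
Proof. by rewrite /lst linearZ mxE. Qed.

Lemma dot_hd_lst (R : realType) (n : nat) (c x : 'cV[R]_(n + 1)) :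
  dot c x = dot (hd c) (hd x) + lst c * lst x.
Proof.
rewrite !dotE big_split_ord /= big_ord1 /hd /lst !mxE.
by congr (_ + _); apply: eq_bigr => i _; rewrite !mxE.
Qed.

Definition lorentz (R : realType) (n : nat) (x y : 'cV[R]_(n + 1)) : R :=
  lst x * lst y - dot (hd x) (hd y).

Lemma lorentzC (R : realType) (n : nat) (x y : 'cV[R]_(n + 1)) :
  lorentz x y = lorentz y x.
Proof. by rewrite /lorentz dotC mulrC. Qed.

Lemma lorentzDl (R : realType) (n : nat) (x y z : 'cV[R]_(n + 1)) :
  lorentz (x + y) z = lorentz x z + lorentz y z.
Proof. by rewrite /lorentz lstD hdD dotDl; ring. Qed.

Lemma lorentzZl (R : realType) (n : nat) (k : R) (x y : 'cV[R]_(n + 1)) :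
  lorentz (k *: x) y = k * lorentz x y.
Proof. by rewrite /lorentz lstZ hdZ dotZl; ring. Qed.

Lemma lorentz_comb (R : realType) (n : nat) (k l : R) (x y : 'cV[R]_(n + 1)) :
  lorentz (k *: x + l *: y) (k *: x + l *: y) =
  k ^+ 2 * lorentz x x + 2 * k * l * lorentz x y + l ^+ 2 * lorentz y y.
Proof.
rewrite lorentzDl !lorentzZl ![lorentz _ (_ + _)]lorentzC !lorentzDl !lorentzZl.
by rewrite (lorentzC y x); ring.
Qed.

(** The vector through which the conic inequality moves [x]: the Lorentz form
against it is, up to sign, the Euclidean product with [d]. *)
Definition flip (R : realType) (n : nat) (d : 'cV[R]_(n + 1)) :
    'cV[R]_(n + 1) :=
  col_mx (hd d) (- lst d)%:M.

Lemma hd_flip (R : realType) (n : nat) (d : 'cV[R]_(n + 1)) :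
  hd (flip d) = hd d.
Proof. exact: col_mxKu. Qed.

Lemma lst_flip (R : realType) (n : nat) (d : 'cV[R]_(n + 1)) :
  lst (flip d) = - lst d.
Proof. by rewrite /lst col_mxKd mxE. Qed.

Lemma lorentz_flipr (R : realType) (n : nat) (x d : 'cV[R]_(n + 1)) :
  lorentz x (flip d) = - dot d x.
Proof.
by rewrite /lorentz hd_flip lst_flip dot_hd_lst (dotC (hd d)); ring.
Qed.

Lemma lorentz_flip2 (R : realType) (n : nat) (d : 'cV[R]_(n + 1)) :
  lorentz (flip d) (flip d) = lorentz d d.
Proof. by rewrite /lorentz hd_flip lst_flip mulrNN. Qed.

(** * The second-order cone *)

Lemma socP (R : realType) (n : nat) (x : 'cV[R]_(n + 1)) :
  soc R n x <-> 0 <= lst x /\ 0 <= lorentz x x.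
Proof.
rewrite /soc /= /lorentz -expr2 -sqr_norm2 subr_ge0.
split=> [le_x|[x_ge0]]; last by rewrite ler_sqr ?nnegrE ?sqrtr_ge0.
have x_ge0 : 0 <= lst x by apply: le_trans le_x; exact: sqrtr_ge0.
by rewrite ler_sqr ?nnegrE ?sqrtr_ge0.
Qed.

(** Self-duality of the cone.  Expanding the square norm of
[lst y hd x - lst x hd y] gives the claim multiplied by [2 lst x lst y], which
is Cauchy-Schwarz; when that factor vanishes, so does one of the two heads. *)
Lemma soc_lorentz_ge0 (R : realType) (n : nat) (x y : 'cV[R]_(n + 1)) :
  soc R n x -> soc R n y -> 0 <= lorentz x y.
Proof.
have degenerate (u v : 'cV[R]_(n + 1)) :
    soc R n u -> lst u = 0 -> 0 <= lorentz u v.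
  move=> /socP[_]; rewrite /lorentz => + u0; rewrite u0 !mul0r !sub0r oppr_ge0.
  move=> hu; have : dot (hd u) (hd u) == 0 by rewrite eq_le hu dotxx_ge0.
  by rewrite dotxx_eq0 => /eqP ->; rewrite /dot trmx0 mul0mx mxE oppr0.
move=> xK yK; have /socP[x_ge0 xL] := xK; have /socP[y_ge0 yL] := yK.
have [x0|x_neq0] := eqVneq (lst x) 0; first exact: degenerate.
have [y0|y_neq0] := eqVneq (lst y) 0; first by rewrite lorentzC degenerate.
have x_gt0 : 0 < lst x by rewrite lt_def x_neq0.
have y_gt0 : 0 < lst y by rewrite lt_def y_neq0.
have xy_gt0 := mulr_gt0 x_gt0 y_gt0.
have sq_ge0 := dotxx_ge0 (lst y *: hd x - lst x *: hd y).
rewrite dotBl !dotZl !(dotC _ (_ - _)) !dotBl !dotZl in sq_ge0.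
rewrite (dotC (hd y) (hd x)) in sq_ge0.
move: xL yL; rewrite -(pmulr_rge0 (lorentz x y) xy_gt0) /lorentz => xL yL.
have := mulr_ge0 (sqr_ge0 (lst y)) xL; have := mulr_ge0 (sqr_ge0 (lst x)) yL.
by lra.
Qed.

(** The sign of the last entry decides which of the two cones would contain a
vector of nonnegative square. *)
Lemma notin_pm_soc_lorentz_lt0 (R : realType) (n : nat) (d : 'cV[R]_(n + 1)) :
  ~ soc R n d -> ~ [set - y | y in soc R n] d -> lorentz d d < 0.
Proof.
move=> dK dNK; rewrite ltNge; apply/negP => dd.
have [d_ge0|d_lt0] := leP 0 (lst d); first by apply/dK/socP.
apply: dNK; exists (- d); last by rewrite opprK.
rewrite -scaleN1r; apply/socP; rewrite lstZ lorentzZl lorentzC lorentzZl; split.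
  by rewrite mulN1r oppr_ge0 ltW.
by rewrite mulrA mulrNN !mul1r.
Qed.

(** A translate of a point of the cone along a direction of negative square can
only reach the opposite cone by staying in the cone: if [x + k w] is in the
opposite cone then [- k w = x - (x + k w)] has nonnegative square, so [k = 0]. *)
Lemma soc_add_lorentz_lt0 (R : realType) (n : nat) (k : R)
    (x w : 'cV[R]_(n + 1)) :
  soc R n x -> lorentz w w < 0 ->
  soc R n (x + k *: w) <-> 0 <= lorentz (x + k *: w) (x + k *: w).
Proof.
move=> xK ww; split=> [/socP[]//|vv]; set v := x + k *: w in vv *.
have [v_ge0|v_lt0] := leP 0 (lst v); first exact/socP.
have vNK : soc R n (-1 *: v).
  apply/socP; rewrite lstZ lorentzZl lorentzC lorentzZl mulrA mulrNN !mul1r.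
  by rewrite mulN1r oppr_ge0 ltW.
have xv := soc_lorentz_ge0 xK vNK; have /socP[_ xx] := xK.
have : 0 <= lorentz (1 *: x + 1 *: (-1 *: v)) (1 *: x + 1 *: (-1 *: v)).
  have /socP[_ vv'] := vNK.
  by rewrite lorentz_comb; lra.
have -> : 1 *: x + 1 *: (-1 *: v) = - k *: w.
  by rewrite !scale1r scaleN1r /v opprD addrA subrr sub0r scaleNr.
rewrite lorentzZl lorentzC lorentzZl mulrA mulrNN -expr2 nmulr_lge0 // => k2.
have /eqP k0 : k == 0 by rewrite -sqrf_eq0 eq_le k2 sqr_ge0.
by rewrite /v k0 scale0r addr0.
Qed.

(** * The two inequalities *)

(** The root is at least both [p - r] and [r - p], and each of them is [p + r]
minus twice one of the summands. *)
Lemma sum_le_sqrt (R : realType) (p r s : R) :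
  0 <= s -> p <= 0 \/ r <= 0 -> p + r <= Num.sqrt ((p - r) ^+ 2 + s).
Proof.
move=> s_ge0 pr; apply: (@le_trans _ _ `|p - r|).
  by case: ger0P => ?; case: pr; lra.
by rewrite -sqrtr_sqr ler_wsqrtr // lerDl.
Qed.

(** The upper bound on [p + r] is what allows squaring: without it, a large
positive [p + r] would satisfy the left-hand side for free. *)
Lemma opp_sum_le_sqrt (R : realType) (p r s : R) :
  0 <= s -> p + r <= Num.sqrt ((p - r) ^+ 2 + s) ->
  - (p + r) <= Num.sqrt ((p - r) ^+ 2 + s) <-> 4 * p * r <= s.
Proof.
move=> s_ge0 le_pr; have X_ge0 : 0 <= (p - r) ^+ 2 + s.
  by rewrite addr_ge0 ?sqr_ge0.
have -> : (4 * p * r <= s) = ((p + r) ^+ 2 <= (p - r) ^+ 2 + s).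
  by apply/idP/idP; lra.
rewrite -[X in _ ^+ 2 <= X]sqr_sqrtr // -[(p + r) ^+ 2]real_normK ?num_real //.
rewrite ler_sqr ?nnegrE ?sqrtr_ge0 // ler_norml le_pr andbT lerNl.
by split.
Qed.

(** The cross terms combine with the square of [flip d] because [flip d] has the
same square [- N] as [d]; this is what makes [N] factor out.  It will be used with
[k = c2^T x - c20], so that [dot d x + k = beta c1^T x - c20]. *)
Lemma lorentz_reflected (R : realType) (n : nat) (k : R) (x d : 'cV[R]_(n + 1)) :
  let N := - lorentz d d in
  let v := N *: x + (2 * k) *: flip d in
  lorentz v v = N * (N * lorentz x x - 4 * (dot d x + k) * k).
Proof. by rewrite /= lorentz_comb lorentz_flipr lorentz_flip2; ring. Qed.

Theorem proposition3 (R : realType) (n : nat)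
    (c1 c2 : 'cV[R]_(n + 1)) (c10 c20 beta : R)
    (c10_sign : c10 \in [:: 0; 1; -1]) (c20_sign : c20 \in [:: 0; 1; -1])
    (c20_le_c10 : c20 <= c10)
    (C1_nsub_C2 : ~ (disj_term c1 c10 `<=` disj_term c2 c20))
    (C2_nsub_C1 : ~ (disj_term c2 c20 `<=` disj_term c1 c10))
    (C1_int : disj_term c1 c10 `&` (soc R n)° !=set0)
    (C2_int : disj_term c2 c20 `&` (soc R n)° !=set0)
    (beta_gt0 : 0 < beta) (c20_le_beta : c20 <= beta * c10)
    (beta_nsoc : ~ soc R n (beta *: c1 - c2))
    (beta_nopp_soc : ~ [set - y | y in soc R n] (beta *: c1 - c2)) :
  (forall x : 'cV[R]_(n + 1), soc R n x ->
     beta * dot c1 x <= c20 \/ dot c2 x <= c20 ->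
     - (2 * c20) + dot (beta *: c1 + c2) x <=
       Num.sqrt (dot (beta *: c1 - c2) x ^+ 2 +
                 N1 c1 c2 beta * (lst x ^+ 2 - norm2 (hd x) ^+ 2)))
  /\
  ([set x : 'cV[R]_(n + 1) |
      [/\ soc R n x, c20 < beta * dot c1 x & c20 < dot c2 x]] = set0 ->
   (forall x : 'cV[R]_(n + 1), soc R n x ->
      - (2 * c20) + dot (beta *: c1 + c2) x <=
        Num.sqrt (dot (beta *: c1 - c2) x ^+ 2 +
                  N1 c1 c2 beta * (lst x ^+ 2 - norm2 (hd x) ^+ 2)))
   /\
   (forall x : 'cV[R]_(n + 1), soc R n x ->
      (soc R n (N1 c1 c2 beta *: x +
                (2 * (dot c2 x - c20)) *:
                  col_mx (beta *: hd c1 - hd c2)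
                         (- (beta * lst c1) + lst c2)%:M)
       <->
       2 * c20 - dot (beta *: c1 + c2) x <=
         Num.sqrt (dot (beta *: c1 - c2) x ^+ 2 +
                   N1 c1 c2 beta * (lst x ^+ 2 - norm2 (hd x) ^+ 2))))).
Proof.
set d := beta *: c1 - c2.
have hdd : hd d = beta *: hd c1 - hd c2.
  by rewrite /d -scaleN1r hdD !hdZ scaleN1r.
have lstd : lst d = beta * lst c1 - lst c2.
  by rewrite /d -scaleN1r lstD !lstZ mulN1r.
have NE : N1 c1 c2 beta = - lorentz d d.
  by rewrite /N1 -hdd -lstd sqr_norm2 /lorentz opprB expr2.
have dd_lt0 : lorentz d d < 0 by exact: notin_pm_soc_lorentz_lt0.
have N_gt0 : 0 < - lorentz d d by rewrite oppr_gt0.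
have qE (x : 'cV[R]_(n + 1)) : lst x ^+ 2 - norm2 (hd x) ^+ 2 = lorentz x x.
  by rewrite sqr_norm2 /lorentz expr2.
have sumE (x : 'cV[R]_(n + 1)) : - (2 * c20) + dot (beta *: c1 + c2) x =
    (beta * dot c1 x - c20) + (dot c2 x - c20).
  by rewrite dotDl dotZl; ring.
have diffE (x : 'cV[R]_(n + 1)) :
    dot d x = (beta * dot c1 x - c20) - (dot c2 x - c20).
  by rewrite /d dotBl dotZl; ring.
have Nq_ge0 (x : 'cV[R]_(n + 1)) :
    soc R n x -> 0 <= - lorentz d d * lorentz x x.
  by move=> /socP[_ xx]; apply: mulr_ge0 => //; exact: ltW.
have B (x : 'cV[R]_(n + 1)) : soc R n x ->
    beta * dot c1 x <= c20 \/ dot c2 x <= c20 ->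
    - (2 * c20) + dot (beta *: c1 + c2) x <=
    Num.sqrt (dot d x ^+ 2 +
              N1 c1 c2 beta * (lst x ^+ 2 - norm2 (hd x) ^+ 2)).
  move=> xK ab; rewrite NE qE sumE diffE; apply: sum_le_sqrt (Nq_ge0 _ xK) _.
  by rewrite !subr_le0.
split=> // empty.
have Ball (x : 'cV[R]_(n + 1)) : soc R n x ->
    - (2 * c20) + dot (beta *: c1 + c2) x <=
    Num.sqrt (dot d x ^+ 2 +
              N1 c1 c2 beta * (lst x ^+ 2 - norm2 (hd x) ^+ 2)).
  move=> xK; apply: B => //.
  have [|a_gt] := leP (beta * dot c1 x) c20; first by left.
  have [|b_gt] := leP (dot c2 x) c20; first by right.
  by have : set0 x by rewrite -empty.
split=> // x xK; have := Ball x xK.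
have -> : 2 * c20 - dot (beta *: c1 + c2) x =
    - (- (2 * c20) + dot (beta *: c1 + c2) x) by ring.
have -> : col_mx (beta *: hd c1 - hd c2) (- (beta * lst c1) + lst c2)%:M
    = flip d by rewrite /flip hdd lstd opprB [lst c2 - _]addrC.
rewrite NE qE sumE diffE => Bx.
have NxK : soc R n (- lorentz d d *: x).
  have /socP[x_ge0 xx] := xK; apply/socP.
  rewrite lstZ lorentzZl lorentzC lorentzZl.
  by split; do ?[apply: mulr_ge0 => //]; exact: ltW.
have ww_lt0 : lorentz (flip d) (flip d) < 0 by rewrite lorentz_flip2.
apply: (iff_trans (soc_add_lorentz_lt0 _ NxK ww_lt0)).
apply: iff_sym; apply: (iff_trans (opp_sum_le_sqrt (Nq_ge0 _ xK) Bx)).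
by rewrite lorentz_reflected pmulr_rge0 // subr_ge0 diffE subrK.
Qed.
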